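(* Let $\varepsilon>0$ and grant (NormEq) with constant $C'$ and (Q) with parameters $r$ and $\alpha$. Then every $f\in F$ with $\|f-f^*\|_{L_2}\le r$ satisfies $\|f-f^*\|_{L_2}^2\le\frac4\alpha P\mathcal L_f$.
   Context: Setting: $F$ is a convex class of measurable functions $\mathcal X\to\mathbb R$, $\mathcal Y=\mathbb R$, $(X,Y)\sim P$, $X\sim\mu$, $\|g\|_{L_p}=(\mathbb E|g(X)|^p)^{1/p}$. For $\tau\in(0,1)$ the quantile loss is $\ell_f(x,y)=(y-f(x))(\tau-\mathbf 1\{y-f(x)\le0\})$. $f^*$ is the (unique) minimizer of $f\mapsto P\ell_f=\mathbb E\ell_f(X,Y)$ over $F$, $\mathcal L_f=\ell_f-\ell_{f^*}$, $P\mathcal L_f=\mathbb E\mathcal L_f(X,Y)$. (NormEq): there is $C'>0$ such that $\|f-f^*\|_{L_{2+\varepsilon}}\le C'\|f-f^*\|_{L_2}$ for all $f\in F$. (Q): the conditional distribution of $Y$ given $X=x$ has a density $f_{Y|X=x}$, and there exist $\alpha>0$, $r>0$ such that for all $x\in\mathcal X$ and all $z\in\mathbb R$ with $|z-f^*(x)|\le r(\sqrt2C')^{(2+\varepsilon)/\varepsilon}$, $f_{Y|X=x}(z)\ge\alpha$. *)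

(* Defs.v *)
From HB Require Import structures.
From mathcomp Require Import all_boot all_order all_algebra.
From mathcomp Require Import all_classical all_reals all_analysis.
Set Implicit Arguments. Unset Strict Implicit. Unset Printing Implicit Defensive.
Import Order.TTheory GRing.Theory Num.Theory.
Local Open Scope ring_scope.
Local Open Scope classical_set_scope.

Definition qloss {X : Type} {R : realType} (tau : R) (f : X -> R) (z : X * R) : R :=
  (z.2 - f z.1) * (tau - (if z.2 - f z.1 <= 0 then 1 else 0)).

Definition excess_loss {X : Type} {R : realType} (tau : R) (f fstar : X -> R)
  (z : X * R) : R := qloss tau f z - qloss tau fstar z.

(* ||g||_{L_p} where X ~ mu is the first marginal of the joint law P of (X,Y) *)
Definition LpX {d} {X : measurableType d} {R : realType}
  (P : probability (X * R)%type R) (p : R) (g : X -> R) : \bar R :=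
  Lnorm P p%:E (fun z => (g z.1)%:E).

Definition risk {d} {X : measurableType d} {R : realType}
  (P : probability (X * R)%type R) (tau : R) (f : X -> R) : \bar R :=
  (\int[P]_z (qloss tau f z)%:E)%E.

Definition excess_risk {d} {X : measurableType d} {R : realType}
  (P : probability (X * R)%type R) (tau : R) (f fstar : X -> R) : \bar R :=
  (\int[P]_z (excess_loss tau f fstar z)%:E)%E.

Definition cond_density {d} {X : measurableType d} {R : realType}
  (P : probability (X * R)%type R) (dens : X -> R -> R) : Prop :=
  (forall x y, 0 <= dens x y) /\
  measurable_fun setT (fun z : X * R => dens z.1 z.2) /\
  forall (A : set X) (B : set R), measurable A -> measurable B ->
    P (A `*` B) =
    (\int[P]_(z in A `*` setT) \int[lebesgue_measure]_(y in B) (dens z.1 y)%:E)%E.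

(* Main.v *)
Require Import Defs.
From HB Require Import structures.
From mathcomp Require Import all_boot all_order all_algebra.
From mathcomp Require Import all_classical all_reals all_analysis.
From mathcomp Require Import measurable_realfun ring lra.
Import Order.TTheory GRing.Theory Num.Theory.
Import numFieldNormedType.Exports.
Local Open Scope ring_scope.
Local Open Scope classical_set_scope.

(** Put [h = f - fstar] and [ft = t f + (1 - t) fstar].  The check loss is convex
    in the prediction, and [t L_f - L_ft] is pointwise at least [t |y - f x|]
    when [y] lies between [ft x] and [f x], and nonnegative otherwise.  Since [ft]
    belongs to [F], [P L_ft >= 0].  Where [|h|] is at most the radius [K] of (Q),
    the conditional density is at least [alpha] on that segment, so integrating
    in [y] gives [P L_f >= alpha (1 - t)^2 / 2 * E[h^2 ; |h| <= K]]; let [t] tend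
    to 0.  By (NormEq) and a Markov
    bound, with this choice of [K], the part [|h| <= K] carries at least half of
    [E h^2]. *)

(** * Pointwise convexity of the check loss *)

Lemma qloss_max {X : Type} {R : realType} (tau : R) (f : X -> R) (z : X * R) :
  qloss tau f z = Num.max (tau * (z.2 - f z.1)) ((tau - 1) * (z.2 - f z.1)).
Proof.
rewrite /qloss; set u := z.2 - f z.1.
by have [u0|u0] := leP u 0; [rewrite max_r|rewrite max_l]; nra.
Qed.

(** The terms in [g] combine to [t * qloss f + (1 - t) * qloss g - qloss h], which is nonnegative by
    convexity. When [z.2] separates [h z.1] from [f z.1], different linear pieces are active at
    these two points; their slopes [tau] and [tau - 1] differ by exactly 1, which produces the extra
    [t * |z.2 - f z.1|]. *)
Lemma qloss_gap {X : Type} {R : realType} (tau t : R) (f g : X -> R) (z : X * R)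
    (h := fun x => t * f x + (1 - t) * g x) :
  0 <= t <= 1 ->
  t * (if Num.min (h z.1) (f z.1) <= z.2 <= Num.max (h z.1) (f z.1)
       then `|z.2 - f z.1| else 0)
    <= t * excess_loss tau f g z - excess_loss tau h g z.
Proof.
move=> /andP[t0 t1]; rewrite /excess_loss !qloss_max.
have : h z.1 = t * f z.1 + (1 - t) * g z.1 by [].
move: (f z.1) (g z.1) (h z.1) z.2 => a b c y cE.
set qa := Num.max _ (_ * (y - a)); set qb := Num.max _ (_ * (y - b)).
have t1' : 0 <= 1 - t by lra.
have a1 : t * (tau * (y - a)) <= t * qa by rewrite ler_wpM2l// /qa le_max lexx.
have a2 : t * ((tau - 1) * (y - a)) <= t * qa.
  by rewrite ler_wpM2l// /qa le_max lexx orbT.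
have b1 : (1 - t) * (tau * (y - b)) <= (1 - t) * qb.
  by rewrite ler_wpM2l// /qb le_max lexx.
have b2 : (1 - t) * ((tau - 1) * (y - b)) <= (1 - t) * qb.
  by rewrite ler_wpM2l// /qb le_max lexx orbT.
have [|_] := ifPn; last first.
  rewrite [leRHS](_ : _ = t * qa + (1 - t) * qb
    - Num.max (tau * (y - c)) ((tau - 1) * (y - c))); last by ring.
  by rewrite mulr0 subr_ge0 ge_max cE; apply/andP; split; lra.
have [ca|ac] := leP c a => /andP[h1 h2].
  (* Here [c <= y <= a]: the loss at [c] is the [tau] piece, while [qa] is bounded below by its
     [tau - 1] piece and [qb] by its [tau] piece. *)
  rewrite max_l; last by nra.
  by rewrite ler0_norm ?subr_le0// cE; lra.
rewrite max_r; last by nra.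
by rewrite ger0_norm ?subr_ge0// cE; lra.
Qed.

(** * Lebesgue integrals along a segment *)

Lemma integral_linear {R : realType} (s e a b : R) : a < b ->
  (\int[lebesgue_measure]_(y in `[a, b]) (s * (y - e))%:E
    = (s * ((b - e) ^+ 2 - (a - e) ^+ 2) / 2)%:E)%E.
Proof.
move=> ab; pose F (y : R) : R := s * (y - e) ^+ 2 / 2.
have dF (x : R) : is_derive x 1 F (s * (x - e)).
  rewrite /F; apply: is_derive_eq.
  by rewrite /GRing.scale/=; lra.
have cF : continuous F.
  by move=> x; apply: differentiable_continuous; apply/derivable1_diffP; case: (dF x).
rewrite (@continuous_FTC2 _ _ F)//.
- by rewrite -EFinB /F; congr EFin; lra.
- apply: continuous_subspaceT => x; apply: cvgM; first exact: cvg_cst.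
  by apply: cvgB; [exact: cvg_id|exact: cvg_cst].
- split.
  + by move=> x _; case: (dF x).
  + exact/cvg_at_right_filter/cF.
  + exact/cvg_at_left_filter/cF.
- by move=> x _; rewrite derive1E; apply: derive_val.
Qed.

(** Used with [c = ft x] and [a = f x], where [c - a = (1 - t) * (fstar x - f x)]; this is the
    source of the factor [(1 - t) ^+ 2 / 2]. *)
Lemma integral_dist_segment {R : realType} (a c : R) :
  (\int[lebesgue_measure]_y
     (if (Num.min c a <= y <= Num.max c a)%R then `|y - a| else 0)%R%:E
    = ((c - a) ^+ 2 / 2)%:E)%E.
Proof.
transitivity (\int[lebesgue_measure]_(y in `[Num.min c a, Num.max c a])
    `|y - a|%:E)%E.
  rewrite [RHS]integral_mkcond; apply: eq_integral => y _.
  by rewrite patchE mem_setE in_itv/=; case: ifP.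
have [ca|ac|->] := ltgtP c a; last by rewrite set_itv1 integral_set1 subrr expr0n/= mul0r.
- rewrite -[RHS](_ : (-1 * ((a - a) ^+ 2 - (c - a) ^+ 2) / 2)%:E = _); last first.
    by congr EFin; lra.
  rewrite -integral_linear//; apply: eq_integral => y.
  rewrite inE/= in_itv/= => /andP[_ ya].
  by rewrite ler0_norm ?subr_le0// mulN1r.
- rewrite -[RHS](_ : (1 * ((c - a) ^+ 2 - (a - a) ^+ 2) / 2)%:E = _); last first.
    by congr EFin; lra.
  rewrite -integral_linear//; apply: eq_integral => y.
  rewrite inE/= in_itv/= => /andP[ay _].
  by rewrite ger0_norm ?subr_ge0// mul1r.
Qed.

(** * Measures with a density, and uniqueness of measures on a product *)

(** The proofs [f0] and [mf] are arguments so that the measure structure can be attached to the term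
    [mdensity m f f0 mf] itself. *)
Definition mdensity {d} {T : measurableType d} {R : realType}
    (m : {measure set T -> \bar R}) (f : T -> R)
    (f0 : forall x, 0 <= f x) (mf : measurable_fun setT f) (A : set T) : \bar R :=
  (\int[m]_(x in A) (f x)%:E)%E.

Section mdensity.
Context {d} {T : measurableType d} {R : realType}.
Variables (m : {measure set T -> \bar R}) (f : T -> R).
Hypotheses (f0 : forall x, 0 <= f x) (mf : measurable_fun setT f).

Let mdensity0 : mdensity m f f0 mf set0 = 0%E.
Proof. by rewrite /mdensity integral_set0. Qed.

Let mdensity_ge0 A : (0 <= mdensity m f f0 mf A)%E.
Proof. by apply: integral_ge0 => x _; rewrite lee_fin. Qed.

Let mdensity_sigma_additive : semi_sigma_additive (mdensity m f f0 mf).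
Proof.
move=> A mA tA mUA; rewrite /mdensity ge0_integral_bigcup//.
- by apply: is_cvg_ereal_nneg_natsum_cond => n _ _; exact: mdensity_ge0.
- exact/measurable_EFinP/measurable_funTS.
- by move=> x _; rewrite lee_fin.
Qed.

HB.instance Definition _ := isMeasure.Build _ _ _ (mdensity m f f0 mf)
  mdensity0 mdensity_ge0 mdensity_sigma_additive.

End mdensity.

(** Measurable rectangles are stable under intersection and generate the product sigma-algebra;
    since [m1] is finite, the constant sequence [setT] serves as the exhausting sequence. *)
Lemma measure_prod_unique {d1 d2} {T1 : measurableType d1} {T2 : measurableType d2}
    {R : realType} (m1 m2 : {measure set (T1 * T2) -> \bar R}) :
  (m1 setT < +oo)%E ->
  (forall A B, measurable A -> measurable B -> m1 (A `*` B) = m2 (A `*` B)) ->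
  forall E, measurable E -> m1 E = m2 E.
Proof.
move=> m1oo m12.
pose G : set (set (T1 * T2)) :=
  [set A `*` B | A in measurable & B in measurable].
apply: (measure_unique G (fun=> setT)) => //.
- by rewrite measurable_prod_measurableType.
- move=> _ _ [A1 mA1 [A2 mA2 <-]] [B1 mB1 [B2 mB2 <-]].
  rewrite -setXI; exists (A1 `&` B1); first exact: measurableI.
  by exists (A2 `&` B2) => //; exact: measurableI.
- by move=> _; exists setT => //; exists setT => //; rewrite setXTT.
- by rewrite bigcup_const.
- by move=> _ [A mA [B mB <-]]; exact: m12.
Qed.

(* [lebesgue_measure] is a measure on [measurableTypeR R], whose display is not
   that of the sigma-algebra on [R] used in [X * R]. *)
Definition lebesgueR {R : realType} : set R -> \bar R := @lebesgue_measure R.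

Section lebesgueR.
Context {R : realType}.

HB.instance Definition _ := isMeasure.Build _ R R (@lebesgueR R)
  (@measure0 _ _ _ (@lebesgue_measure R))
  (measure_ge0 (@lebesgue_measure R))
  (@measure_semi_sigma_additive _ _ _ (@lebesgue_measure R)).

HB.instance Definition _ := Measure_isSigmaFinite.Build _ R R (@lebesgueR R)
  (sigma_finiteT (@lebesgue_measure R)).

Let idTR : measurableTypeR R -> R := idfun.

(** [lebesgueR] is the pushforward of [lebesgue_measure] under the identity, so this is a change of
    variables. *)
Lemma ge0_integral_lebesgueR (f : R -> \bar R) (D : set R) :
  measurable D -> measurable_fun D f -> (forall y, D y -> 0 <= f y)%E ->
  (\int[lebesgueR]_(x in D) f x = \int[lebesgue_measure]_(x in D) f x)%E.
Proof.
move=> mD mf f0.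
have midTR : measurable_fun setT idTR by move=> _ Y mY; rewrite setTI.
rewrite (@eq_measure_integral _ _ _ _ (pushforward (@lebesgue_measure R) idTR));
  last by [].
by rewrite ge0_integral_pushforward// => y; rewrite inE; exact: f0.
Qed.

End lebesgueR.

(** * The joint law and its density with respect to the law of X times Lebesgue measure *)

Section cond_density.
Context {d} {X : measurableType d} {R : realType}.
Variables (P : probability (X * R)%type R) (dens : X -> R -> R).

Let mfst := isMeasurableFun.Build _ _ (X * R)%type X fst measurable_fst.
Let fst_mfun : {mfun (X * R)%type >-> X} := HB.pack (@fst X R) mfst.
Let mu : probability X R := distribution P fst_mfun.
Let M := (mu \x lebesgueR)%E.

(** [cond_density] speaks of rectangles only. There, Tonelli identifies its right-hand side with the
    integral of [dens] against [M]; two measures that agree on rectangles, with [P] finite, agree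
    everywhere. *)
Lemma cond_densityE : cond_density P dens -> forall E, measurable E ->
  P E = (\int[M]_(z in E) (dens z.1 z.2)%:E)%E.
Proof.
move=> [dens0 [mdens densE]].
have dens0' (z : X * R) : 0 <= dens z.1 z.2 by [].
apply: (measure_prod_unique P (mdensity M _ dens0' mdens)).
  by rewrite -ge0_fin_numE// fin_num_measure.
move=> A B mA mB; apply: etrans (densE A B mA mB) _; rewrite /mdensity.
(* Extension by zero turns the integral over a rectangle into one over the whole product, where
   Tonelli applies. *)
pose D : X * R -> \bar R := (fun z => (dens z.1 z.2)%:E) \_ (A `*` B).
have D0 z : (0 <= D z)%E by rewrite /D patchE; case: ifP => // _; rewrite lee_fin.
have mD : measurable_fun setT D.
  apply/(measurable_restrictT _ _).1; first exact: measurableX.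
  exact/measurable_EFinP/measurable_funTS.
rewrite [RHS]integral_mkcond fubini_tonelli1//.
rewrite ge0_integral_distribution; last 2 first.
- exact: measurable_fun_fubini_tonelli_F.
- by move=> x; apply: integral_ge0.
rewrite integral_mkcond; apply: eq_integral => -[x y] _ /=.
rewrite /fubini_F patchE.
case: ifPn => [|/negP xA].
  rewrite inE/= => -[xA _].
  rewrite -(@ge0_integral_lebesgueR _ _ B)//; last 2 first.
  - apply/measurable_EFinP/measurable_funTS.
    exact: (measurableT_comp (f := fun z : X * R => dens z.1 z.2)
      mdens (measurable_pair1 x)).
  - by move=> u _; rewrite lee_fin.
  rewrite [LHS]integral_mkcond; apply: eq_integral => u _; rewrite !patchE.
  by congr (if _ then _ else _); apply/idP/idP; rewrite !inE/=; tauto.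
rewrite integral0_eq// => u _; rewrite patchE.
case: ifP => //; rewrite inE/= => -[xA' _]; exfalso; apply: xA.
by rewrite inE.
Qed.

(** On [S] the law [P] dominates [alpha] times [M], and [g] lives on [S]. By Tonelli the iterated
    integral on the left is the integral of [g] against [M]. *)
Lemma cond_density_ge_integral (alpha : R) (S : set (X * R)) :
  cond_density P dens -> 0 <= alpha -> measurable S ->
  (forall z, S z -> alpha <= dens z.1 z.2) ->
  forall g : X * R -> \bar R, (forall z, 0 <= g z)%E -> measurable_fun setT g ->
  (forall z, ~ S z -> g z = 0%E) ->
  (alpha%:E * \int[P]_z \int[lebesgue_measure]_y g (z.1, y) <= \int[P]_z g z)%E.
Proof.
move=> densP alpha0 mS Salpha g g0 mg gS.
have -> : (\int[P]_z \int[lebesgue_measure]_y g (z.1, y) = \int[M]_z g z)%E.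
  transitivity (\int[P]_z \int[lebesgueR]_y g (z.1, y))%E.
    apply: eq_integral => z _; rewrite ge0_integral_lebesgueR//.
    exact: measurableT_comp.
  rewrite fubini_tonelli1// ge0_integral_distribution//.
  - exact: measurable_fun_fubini_tonelli_F.
  - by move=> x; apply: integral_ge0.
have -> : (\int[M]_z g z = \int[M]_(z in S) g z)%E.
  rewrite [RHS]integral_mkcond; apply: eq_integral => z _; rewrite patchE.
  by case: ifPn => // /negP zS; rewrite gS//; move: zS; rewrite inE.
(* Restricting [M] to [S] makes the domination by [P] hold on every measurable set, not just on
   subsets of [S]. *)
have -> : (\int[M]_(z in S) g z = \int[mrestr M mS]_(z in S) g z)%E.
  by apply: eq_measure_integral => A mA AS; rewrite /= /mrestr (setIidl AS).
have mgS : measurable_fun S g by exact: measurable_funTS.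
rewrite -(ge0_integral_mscale _ mS (NngNum alpha0))//.
apply: (@le_trans _ _ (\int[P]_(z in S) g z)%E); last exact: ge0_subset_integral.
apply: ge0_le_measure_integral => // A mA.
have mAS := measurableI _ _ mA mS.
have [_ [mdens _]] := densP.
apply: (@le_trans _ _ (P (A `&` S))); last first.
  by apply: le_measure; rewrite ?inE//; exact: subIsetl.
apply: (@le_trans _ _ (\int[M]_(z in A `&` S) alpha%:E)%E).
  by rewrite integral_cst.
rewrite cond_densityE//; apply: ge0_le_integral => //.
- exact/measurable_EFinP/measurable_funTS.
- by move=> z [_ Sz]; rewrite lee_fin; exact: Salpha.
Qed.

End cond_density.

(** * Truncation of the second moment *)

Lemma powR2D {R : realType} (x e : R) : 0 < e -> 0 <= x ->
  x `^ (2 + e) = x ^+ 2 * x `^ e.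
Proof.
move=> e0 x0; rewrite -(powR_mulrn 2 x0) -powRD//.
by apply/implyP => /eqP; lra.
Qed.

(** The exponent in [K] is chosen so that [K ^ eps = r ^ eps * (sqrt 2 * C) ^ (2 + eps)]. The square
    of [sqrt 2] cancels the division by 2, and what remains is
    [n ^ eps <= r ^ eps * (sqrt 2) ^ eps]. *)
Lemma powR_trunc_bound {R : realType} (eps C r n : R)
    (K := r * (Num.sqrt 2 * C) `^ ((2 + eps) / eps)) :
  0 < eps -> 0 < C -> 0 < r -> 0 <= n <= r ->
  (C * n) `^ (2 + eps) <= K `^ eps * (n ^+ 2 / 2).
Proof.
move=> e0 C0 r0 /andP[n0 nr].
have s0 : 0 < Num.sqrt 2 :> R by rewrite sqrtr_gt0.
have [C0' r0' s0'] := And3 (ltW C0) (ltW r0) (ltW s0).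
rewrite /K [in leRHS]powRM ?powR_ge0// -powRrM divfK ?gt_eqF//.
rewrite !powRM// !powR2D// sqr_sqrtr//.
have S1 : 1 <= Num.sqrt 2 `^ eps :> R.
  rewrite -[leLHS](powRr0 (Num.sqrt 2)) ler_powR // ?(ltW e0)//.
  by rewrite -[leLHS]sqrtr1 ler_wsqrtr// ler1n.
have neps : n `^ eps <= r `^ eps.
  by apply: ge0_ler_powR; rewrite ?nnegrE// ltW.
have Ce : 0 <= C `^ eps by exact: powR_ge0.
have h : 0 <= C ^+ 2 * C `^ eps * n ^+ 2 by rewrite !mulr_ge0 ?sqr_ge0.
have h2 : n `^ eps <= r `^ eps * Num.sqrt 2 `^ eps.
  by apply: (le_trans neps); rewrite ler_peMr ?powR_ge0.
have := ler_wpM2l h h2; lra.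
Qed.

Lemma truncated_second_moment {d} {T : measurableType d} {R : realType}
    (P : {measure set T -> \bar R}) (h : T -> R) (eps C r : R)
    (K := r * (Num.sqrt 2 * C) `^ ((2 + eps) / eps)) :
  measurable_fun setT h -> 0 < eps -> 0 < C -> 0 < r ->
  (Lnorm P (2 + eps)%:E (EFin \o h) <= C%:E * Lnorm P 2%:E (EFin \o h))%E ->
  (Lnorm P 2%:E (EFin \o h) <= r%:E)%E ->
  (Lnorm P 2%:E (EFin \o h) * Lnorm P 2%:E (EFin \o h)
    <= 2%:E * \int[P]_x (if (`|h x| <= K)%R then h x ^+ 2 else 0)%:E)%E.
Proof.
move=> mh e0 C0 r0.
have := Lnorm_ge0 P 2%:E (EFin \o h).
case En : (Lnorm P 2%:E (EFin \o h)) => [n| |]//; rewrite lee_fin => n0 hC.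
rewrite lee_fin => nr.
have s0 : 0 < Num.sqrt 2 * C by rewrite mulr_gt0// sqrtr_gt0.
have K0 : 0 < K by rewrite mulr_gt0// powR_gt0.
have Ke0 : 0 < K `^ eps by rewrite powR_gt0.
have e2 : 2 + eps != 0 by lra.
have mabs : measurable_fun setT (fun x => `|h x|) by exact: measurableT_comp.
set tr := fun x => if `|h x| <= K then h x ^+ 2 else 0.
have tr0 x : 0 <= tr x by rewrite /tr; case: ifP => // _; exact: sqr_ge0.
have mtr : measurable_fun setT tr.
  apply: measurable_fun_ifT => //; first exact: measurable_fun_ler.
  exact: measurable_funX.
have second : (\int[P]_x (h x ^+ 2)%:E = (n ^+ 2)%:E)%E.
  rewrite -powR_mulrn// -poweR_EFin -En poweR_Lnorm//.
  by apply: eq_integral => x _; rewrite /= powR_mulrn// real_normK// num_real.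
have high : (\int[P]_x (`|h x| `^ (2 + eps))%:E <= (K `^ eps * (n ^+ 2 / 2))%:E)%E.
  apply: (@le_trans _ _ (((C * n) `^ (2 + eps))%:E)); last first.
    by rewrite lee_fin; apply: powR_trunc_bound => //; rewrite n0.
  rewrite [leLHS](_ : _ = Lnorm P (2 + eps)%:E (EFin \o h) `^ (2 + eps))%E.
    rewrite -poweR_EFin; apply: gt0_ler_poweR => //; first lra.
    + by rewrite in_itv/= Lnorm_ge0 leey.
    + by rewrite in_itv/= leey andbT lee_fin mulr_ge0// ltW.
  by rewrite poweR_Lnorm.
(* Markov bound in pointwise form: where [|h x| > K], the ratio [(|h x| / K) ^ eps] is at least 1.
   After integration, [high] bounds the second term by [n ^+ 2 / 2]. *)
have tail x : h x ^+ 2 <= tr x + (K `^ eps)^-1 * `|h x| `^ (2 + eps).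
  rewrite /tr; case: ifPn => [_|]; first by rewrite lerDl mulr_ge0 ?powR_ge0 ?invr_ge0 ?ltW.
  rewrite -ltNge => Kh; rewrite add0r powR2D// real_normK ?num_real// mulrCA ler_peMr ?sqr_ge0//.
  rewrite mulrC ler_pdivlMr// mul1r; apply: ge0_ler_powR; rewrite ?nnegrE//; exact: ltW.
have mhigh : measurable_fun setT (fun x => `|h x| `^ (2 + eps)).
  by apply: (measurableT_comp (measurable_powR _)).
have : ((n ^+ 2)%:E <= \int[P]_x (tr x)%:E + (n ^+ 2 / 2)%:E)%E.
  rewrite -second.
  apply: (@le_trans _ _ (\int[P]_x ((tr x)%:E +
      (K `^ eps)^-1%:E * (`|h x| `^ (2 + eps))%:E))%E).
    apply: ge0_le_integral => //.
    - by move=> x _; rewrite lee_fin sqr_ge0.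
    - by apply/measurable_EFinP; exact: measurable_funX.
    - apply/measurable_EFinP/measurable_funD => //; exact: measurable_funM.
    - by move=> x _; rewrite lee_fin.
  rewrite ge0_integralD//; last 4 first.
  - by move=> x _; rewrite lee_fin.
  - exact/measurable_EFinP.
  - by move=> x _; rewrite lee_fin mulr_ge0 ?powR_ge0 ?invr_ge0 ?ltW.
  - by apply/measurable_EFinP; exact: measurable_funM.
  rewrite leeD2l// ge0_integralZl_EFin//; last 2 first.
  - exact/measurable_EFinP.
  - by rewrite invr_ge0 ltW.
  apply: le_trans (lee_wpmul2l _ high) _; first by rewrite lee_fin invr_ge0 ltW.
  by rewrite -EFinM lee_fin mulKf ?gt_eqF.
have : (0 <= \int[P]_x (tr x)%:E)%E by apply: integral_ge0 => x _; rewrite lee_fin.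
case: (\int[P]_x (tr x)%:E)%E => [u| |]//.
  by rewrite -EFinD -!EFinM !lee_fin => _ ?; lra.
by move=> _ _; rewrite gt0_muley// leey.
Qed.

(** * Quadratic lower bound on the excess risk *)

Lemma excess_risk_ge_quadratic {d} {X : measurableType d} {R : realType}
    (P : probability (X * R)%type R) (dens : X -> R -> R)
    (tau alpha K t : R) (f fstar : X -> R)
    (ft := fun x => t * f x + (1 - t) * fstar x) :
  measurable_fun setT f -> measurable_fun setT fstar ->
  P.-integrable setT (fun z => (qloss tau f z)%:E) ->
  P.-integrable setT (fun z => (qloss tau fstar z)%:E) ->
  P.-integrable setT (fun z => (qloss tau ft z)%:E) ->
  (risk P tau fstar <= risk P tau ft)%E ->
  cond_density P dens -> 0 <= alpha ->
  (forall x y, `|y - fstar x| <= K -> alpha <= dens x y) ->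
  0 < t <= 1 ->
  ((alpha * ((1 - t) ^+ 2 / 2))%:E * \int[P]_z
     (if (`|f z.1 - fstar z.1| <= K)%R then (f z.1 - fstar z.1) ^+ 2 else 0)%:E
   <= excess_risk P tau f fstar)%E.
Proof.
move=> mf mfs intf ints intt riskt densP alpha0 Kalpha /andP[t0 t1].
have mf1 : measurable_fun setT (fun z : X * R => f z.1).
  exact: measurableT_comp.
have ms1 : measurable_fun setT (fun z : X * R => fstar z.1).
  exact: measurableT_comp.
have mft1 : measurable_fun setT (fun z : X * R => ft z.1).
  by apply: measurable_funD; exact: measurable_funM.
have mh : measurable_fun setT (fun z : X * R => `|f z.1 - fstar z.1|).
  by apply: measurableT_comp => //; exact: measurable_funB.
pose gap (z : X * R) : R :=
  if Num.min (ft z.1) (f z.1) <= z.2 <= Num.max (ft z.1) (f z.1)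
  then `|z.2 - f z.1| else 0.
have gap0 z : 0 <= gap z by rewrite /gap; case: ifP.
have mgap : measurable_fun setT gap.
  apply: measurable_fun_ifT => //.
  - apply: measurable_and; apply: measurable_fun_ler => //.
    + exact: measurable_minr.
    + exact: measurable_maxr.
  - by apply: measurableT_comp => //; exact: measurable_funB.
pose g (z : X * R) : R := if `|f z.1 - fstar z.1| <= K then gap z else 0.
have g0 z : 0 <= g z by rewrite /g; case: ifP.
have mg : measurable_fun setT g.
  by apply: measurable_fun_ifT => //; exact: measurable_fun_ler.
pose S := [set z : X * R | `|z.2 - fstar z.1| <= K].
have mS : measurable S.
  rewrite -[S]setTI; apply: (measurable_fun_ler
    (f := fun z : X * R => `|z.2 - fstar z.1|) (g := cst K)) => //.
  by apply: measurableT_comp => //; exact: measurable_funB.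
(* If [|f - fstar| <= K] at [z.1], then both [f] and [ft] lie within [K] of [fstar] there, and so
   does every point between them. *)
have gS z : ~ S z -> (g z)%:E = 0%E.
  move=> zS; congr EFin; rewrite /g; case: ifPn => // hK.
  rewrite /gap; case: ifPn => // zI; exfalso; apply: zS.
  rewrite /S/=; move: hK zI; rewrite /ft ge_min le_max ![`|_ - fstar _| <= _]ler_norml.
  by move=> /andP[] ? ? /andP[] /orP[]? /orP[]?; nra.
have lower : (alpha%:E * \int[P]_z \int[lebesgue_measure]_y (g (z.1, y))%:E
    <= \int[P]_z (g z)%:E)%E.
  apply: (cond_density_ge_integral P dens alpha S) => //.
  - by move=> z; exact: Kalpha.
  - exact/measurable_EFinP.
have intex : P.-integrable setT (fun z => (excess_loss tau f fstar z)%:E).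
  by under eq_fun do rewrite EFinB; exact: integrableB.
have intext : P.-integrable setT (fun z => (excess_loss tau ft fstar z)%:E).
  by under eq_fun do rewrite EFinB; exact: integrableB.
(* This is the minimality of [fstar] tested against [ft]. *)
have ext0 : (0 <= \int[P]_z (excess_loss tau ft fstar z)%:E)%E.
  under eq_integral do rewrite EFinB.
  rewrite integralB//= sube_ge0//.
  by rewrite integrable_fin_num.
(* [qloss_gap] is integrated and the nonnegative excess risk of [ft] dropped. The factor [t] stands
   on both sides and cancels, so the bound survives as [t] tends to 0. *)
have upper : (t%:E * \int[P]_z (g z)%:E <= t%:E * excess_risk P tau f fstar)%E.
  rewrite -ge0_integralZl_EFin//; last 3 first.
  - by move=> z _; rewrite lee_fin.
  - exact/measurable_EFinP.
  - exact: ltW.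
  apply: (@le_trans _ _ (\int[P]_z (t%:E * (excess_loss tau f fstar z)%:E
      - (excess_loss tau ft fstar z)%:E))%E).
    apply: ge0_le_integral => //.
    - by move=> z _; rewrite -EFinM lee_fin mulr_ge0// ltW.
    - exact/measurable_funeM/measurable_EFinP.
    - apply: emeasurable_funB; last exact: measurable_int intext.
      by apply: measurable_funeM; exact: measurable_int intex.
    - move=> z _; rewrite -!EFinM -EFinB lee_fin.
      apply: le_trans (qloss_gap _ _ _ _ _ _); last by rewrite ltW.
      rewrite ler_wpM2l//; first exact: ltW.
      by rewrite /g; case: ifP => // _; exact: gap0.
  rewrite integralB//=; last exact: integrableZl.
  by rewrite integralZl// leeBlDr ?integrable_fin_num// leeDl.
move: upper; rewrite lee_pmul2l ?lte_fin// => upper.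
apply: le_trans upper; apply: le_trans lower.
rewrite EFinM -muleA; apply: lee_wpmul2l; first by rewrite lee_fin.
rewrite -ge0_integralZl_EFin//; last 3 first.
- by move=> z _; rewrite lee_fin; case: ifP => // _; exact: sqr_ge0.
- apply/measurable_EFinP/measurable_fun_ifT => //; first exact: measurable_fun_ler.
  by apply: measurable_funX; exact: measurable_funB.
- by rewrite divr_ge0// sqr_ge0.
rewrite le_eqVlt; apply/orP; left; apply/eqP; apply: eq_integral => z _.
rewrite /g /gap /=; case: ifP => hK; last by rewrite mule0 integral0.
by rewrite integral_dist_segment -EFinM; congr EFin; rewrite /ft; lra.
Qed.

Theorem theorem6 (d : measure_display) (X : measurableType d) (R : realType)
  (P : probability (X * R)%type R) (tau : R) (F : set (X -> R)) (fstar : X -> R)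
  (eps C' alpha r : R) (dens : X -> R -> R) :
  0 < tau < 1 ->
  (* F is a convex class of measurable functions *)
  (forall f, F f -> measurable_fun setT f) ->
  (forall f g (t : R), F f -> F g -> 0 <= t <= 1 ->
     F (fun x => t * f x + (1 - t) * g x)) ->
  (* the risks P l_f are well defined (l_f integrable) *)
  (forall f, F f -> P.-integrable setT (fun z => (qloss tau f z)%:E)) ->
  (* f* is the unique minimizer of f |-> P l_f over F *)
  F fstar ->
  (forall f, F f -> (risk P tau fstar <= risk P tau f)%E) ->
  (forall g, F g -> (forall f, F f -> (risk P tau g <= risk P tau f)%E) -> g = fstar) ->
  0 < eps ->
  (* (NormEq) *)
  0 < C' ->
  (forall f, F f ->
     (LpX P (2 + eps) (fun x => (f x - fstar x)%R)
       <= C'%:E * LpX P 2 (fun x => (f x - fstar x)%R))%E) ->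
  (* (Q) *)
  0 < alpha -> 0 < r ->
  cond_density P dens ->
  (forall x z, `|z - fstar x| <= r * (Num.sqrt 2 * C') `^ ((2 + eps) / eps) ->
     alpha <= dens x z) ->
  (* conclusion *)
  forall f, F f -> (LpX P 2 (fun x => (f x - fstar x)%R) <= r%:E)%E ->
    (LpX P 2 (fun x => (f x - fstar x)%R) * LpX P 2 (fun x => (f x - fstar x)%R)
      <= (4 / alpha)%:E * excess_risk P tau f fstar)%E.
Proof.
move=> _ mF convF intF Fs minF _ e0 C0 normeq alpha0 r0 densP lowdens f Ff fr.
set K := r * _ in lowdens.
have mf := mF f Ff; have ms := mF fstar Fs.
have := truncated_second_moment P (fun z => f z.1 - fstar z.1) eps C' r.
rewrite -/K -/(LpX P (2 + eps) (fun x => f x - fstar x)) -/(LpX P 2 (fun x => f x - fstar x)).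
move=> /(_ _ e0 C0 r0 (normeq f Ff) fr).
set tr := (\int[P]_z _)%E => trunc.
have mh : measurable_fun setT (fun z : X * R => f z.1 - fstar z.1).
  by apply: measurable_funB; exact: measurableT_comp.
move: {trunc} (trunc mh).
have tr0 : (0 <= tr)%E.
  by apply: integral_ge0 => z _; rewrite lee_fin; case: ifP => // _; exact: sqr_ge0.
have step t : 0 < t <= 1 ->
    ((alpha * ((1 - t) ^+ 2 / 2))%:E * tr <= excess_risk P tau f fstar)%E.
  move=> t01; have Fft : F (fun x => t * f x + (1 - t) * fstar x).
    by apply: convF => //; case/andP: t01 => /ltW -> ->.
  by apply: (excess_risk_ge_quadratic P dens) => //; [exact: intF|exact: intF|
    exact: intF|exact: minF|exact: ltW].
have : excess_risk P tau f fstar \is a fin_num.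
  rewrite /excess_risk integrable_fin_num//.
  by under eq_fun do rewrite EFinB; apply: integrableB => //; exact: intF.
case: (excess_risk P tau f fstar) step => [e| |]// step _.
(* Any fixed [t] strictly between 0 and 1 gives a positive coefficient, so an infinite [tr] would
   contradict the finite excess risk; [t = 1/2] is taken. *)
have : (tr < +oo)%E.
  rewrite ltey; apply/eqP => troo.
  have half : 0 < (2^-1 : R) <= 1 by lra.
  have c0 : 0 < alpha * ((1 - (2^-1 : R)) ^+ 2 / 2).
    by rewrite mulr_gt0// divr_gt0// exprn_gt0//; lra.
  by have := step _ half; rewrite troo gt0_muley ?lte_fin.
case: tr tr0 step => [s| |]// s0 step _.
have : (0 <= LpX P 2 (fun x => f x - fstar x)%R)%E by exact: Lnorm_ge0.
case: (LpX P 2 _) fr => [n| |]// _ _.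
rewrite -!EFinM !lee_fin mulrAC ler_pdivlMr// => ns.
rewrite lee_fin in s0.
have {}step t : 0 < t <= 1 -> alpha * ((1 - t) ^+ 2 / 2) * s <= e.
  by move=> /step; rewrite -EFinM lee_fin.
have as0 : 0 <= alpha * s by rewrite mulr_ge0// ltW.
have : alpha * s / 2 <= e.
  apply/ler_addgt0Pr => x x0.
  (* The limit [t] to 0, done with a slack [x]: expanding [(1 - t) ^+ 2] costs at most
     [t * alpha * s <= x]. The added 1 keeps the denominator positive when [s = 0]. *)
  set t := Num.min 1 (x / (alpha * s + 1)).
  have as1 : 0 < alpha * s + 1 by lra.
  have t0 : 0 < t by rewrite lt_min ltr01 divr_gt0.
  have t1 : t <= 1 by rewrite ge_min lexx.
  have tx : t * (alpha * s + 1) <= x by rewrite -ler_pdivlMr// ge_min lexx orbT.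
  have := step t; rewrite t0 t1 => /(_ isT).
  have : 0 <= alpha * s * t ^+ 2 by rewrite mulr_ge0// sqr_ge0.
  lra.
(* The constant 4 is a product of two factors 2: one from truncation, [n * n <= 2 * s], and one from
   the integral along the segment, [alpha * s / 2 <= e]. *)
have := ler_wpM2l (ltW alpha0) ns.
lra.
Qed.
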